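(* Let $d,n\geq 1$ be integers and let $\boldsymbol{\lambda}\in\mathcal{P}(d,n)$ be a $d$-partition of $n$. Let $V_{\boldsymbol{\lambda}}$ be a $\mathbb{C}(q)$-vector space with a basis $\{\mathbf{v}_{\mathcal{T}}\}$ indexed by the standard $d$-tableaux $\mathcal{T}$ of shape $\boldsymbol{\lambda}$, and set $\mathbf{v}_{\mathcal{T}}:=0$ for any non-standard $d$-tableau $\mathcal{T}$ of shape $\boldsymbol{\lambda}$. Then $V_{\boldsymbol{\lambda}}$ is a representation of $\mathbb{C}(q){\rm Y}_{d,n}(q)$ with the action of the generators on each basis element $\mathbf{v}_{\mathcal{T}}$ ($\mathcal{T}$ standard of shape $\boldsymbol{\lambda}$) defined as follows, where $\mathrm{p}_i:=\mathrm{p}(\mathcal{T}|i)$ and $\mathrm{c}_i:=\mathrm{c}(\mathcal{T}|i)$ for $i=1,\dots,n$: for $j=1,\dots,n$, $$t_j(\mathbf{v}_{\mathcal{T}})=\xi_{\mathrm{p}_j}\mathbf{v}_{\mathcal{T}};$$ for $i=1,\dots,n-1$, if $\mathrm{p}_i\neq\mathrm{p}_{i+1}$ then $$g_i(\mathbf{v}_{\mathcal{T}})=\mathbf{v}_{\mathcal{T}^{s_i}},$$ and if $\mathrm{p}_i=\mathrm{p}_{i+1}$ then $$g_i(\mathbf{v}_{\mathcal{T}})=\frac{\mathrm{c}_{i+1}(q-q^{-1})}{\mathrm{c}_{i+1}-\mathrm{c}_i}\,\mathbf{v}_{\mathcal{T}}+\frac{q\,\mathrm{c}_{i+1}-q^{-1}\mathrm{c}_i}{\mathrm{c}_{i+1}-\mathrm{c}_i}\,\mathbf{v}_{\mathcal{T}^{s_i}},$$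 where $s_i$ is the transposition $(i,i+1)$.
   Context: Let $q$ be an indeterminate. The Yokonuma--Hecke algebra ${\rm Y}_{d,n}(q)$ is the associative unital $\mathbb{C}[q,q^{-1}]$-algebra generated by $g_1,\dots,g_{n-1},t_1,\dots,t_n$ subject to: $g_ig_j=g_jg_i$ for $|i-j|>1$; $g_ig_{i+1}g_i=g_{i+1}g_ig_{i+1}$ for $i=1,\dots,n-2$; $t_it_j=t_jt_i$ for all $i,j$; $t_jg_i=g_it_{s_i(j)}$ for all $i,j$, where $s_i$ is the transposition $(i,i+1)$; $t_j^d=1$ for all $j$; and $g_i^2=1+(q-q^{-1})e_ig_i$ for all $i$, where $e_i=\frac1d\sum_{s=0}^{d-1}t_i^st_{i+1}^{-s}$. Write $\mathbb{C}(q){\rm Y}_{d,n}(q)=\mathbb{C}(q)\otimes_{\mathbb{C}[q,q^{-1}]}{\rm Y}_{d,n}(q)$. A $d$-partition of $n$ is a $d$-tuple $\boldsymbol{\lambda}=(\boldsymbol{\lambda}^{(1)},\dots,\boldsymbol{\lambda}^{(d)})$ of (possibly empty) partitions of total size $n$; $\mathcal{P}(d,n)$ is the set of all of them. A $d$-node of $\boldsymbol{\lambda}$ is a triple $\boldsymbol{\theta}=(x,y,k)$ where $(x,y)$ (row $x$, column $y$) is a node of the Young diagram of $\boldsymbol{\lambda}^{(k)}$; its position is $\mathrm{p}(\boldsymbol{\theta})=k$ and its quantum content is $\mathrm{c}(\boldsymbol{\theta})=q^{2(y-x)}$. A $d$-tableau of shape $\boldsymbol{\lambda}$ is a bijection between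 $\{1,\dots,n\}$ and the set of $d$-nodes of $\boldsymbol{\lambda}$; it is standard if its entries increase along every row and down every column of each diagram. For a $d$-tableau $\mathcal{T}$, $\mathrm{p}(\mathcal{T}|i)$ and $\mathrm{c}(\mathcal{T}|i)$ denote the position and quantum content of the $d$-node containing $i$, and for $\sigma\in\mathfrak{S}_n$, $\mathcal{T}^{\sigma}$ is the $d$-tableau obtained by applying $\sigma$ to the entries of $\mathcal{T}$ (it need not be standard). $\{\xi_1,\dots,\xi_d\}$ is the set of all $d$-th roots of unity in $\mathbb{C}$, ordered arbitrarily. *)

(* Defs.v *)
From HB Require Import structures.
From mathcomp Require Import all_boot all_order all_algebra.
From mathcomp Require Import perm generic_quotient ring_quotient fraction.
From mathcomp Require Import monalg complex boolp reals.

Set Implicit Arguments.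
Unset Strict Implicit.
Unset Printing Implicit Defensive.

Import GRing.Theory.
Local Open Scope ring_scope.
Local Open Scope quotient_scope.

Notation free_alg K X := {malg K[{fmonom X}]}.

Definition fgen (K : comNzRingType) (X : choiceType) (x : X) : free_alg K X :=
  << fmu x >>.
Arguments fgen K {X} x.

Lemma free_alg_mulC (K : comNzRingType) (X : choiceType) (c : K)
    (x : free_alg K X) : x * c%:MP = c *: x.
Proof.
rewrite -mul_malgC !malgM_def fgmulUg fgmulgU; apply: eq_bigr => m _.
by rewrite mul1m mulm1 mulrC.
Qed.

Section PresentedAlgebra.
Variables (K : comNzRingType) (X : choiceType).
Local Notation F := (free_alg K X).
Variable rel : F -> F -> Prop.

(* The two-sided ideal generated by the differences l - r with rel l r; it is *)
(* stable under scalars since k *: x = k%:MP * x in the free algebra.         *)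
Inductive rel_ideal : F -> Prop :=
| rel_ideal_gen u v l r : rel l r -> rel_ideal (u * (l - r) * v)
| rel_ideal0 : rel_ideal 0
| rel_idealD x y : rel_ideal x -> rel_ideal y -> rel_ideal (x + y).

Lemma rel_idealMl a x : rel_ideal x -> rel_ideal (a * x).
Proof.
elim=> [u v l r lr||y z _ Iy _ Iz].
- by rewrite !mulrA; exact: rel_ideal_gen.
- by rewrite mulr0; exact: rel_ideal0.
- by rewrite mulrDr; exact: rel_idealD.
Qed.

Lemma rel_idealMr a x : rel_ideal x -> rel_ideal (x * a).
Proof.
elim=> [u v l r lr||y z _ Iy _ Iz].
- by rewrite -mulrA; exact: rel_ideal_gen.
- by rewrite mul0r; exact: rel_ideal0.
- by rewrite mulrDl; exact: rel_idealD.
Qed.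

Definition rel_ideal_pred : {pred F} := fun x => `[< rel_ideal x >].

Lemma rel_ideal_predP x : reflect (rel_ideal x) (x \in rel_ideal_pred).
Proof. exact: asboolP. Qed.

Lemma rel_ideal_zmod_closed : zmod_closed rel_ideal_pred.
Proof.
split=> [|x y /rel_ideal_predP Ix /rel_ideal_predP Iy]; apply/rel_ideal_predP.
  exact: rel_ideal0.
by apply: rel_idealD => //; rewrite -mulN1r; apply: rel_idealMl.
Qed.
HB.instance Definition _ :=
  GRing.isZmodClosed.Build F rel_ideal_pred rel_ideal_zmod_closed.


Definition presented_alg := Quotient.quot rel_ideal_pred.
HB.instance Definition _ := GRing.Zmodule.on presented_alg.

Local Notation Q := (Quotient.quot rel_ideal_pred).
Definition pclass (x : F) : presented_alg := \pi_Q x.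

Lemma pclass_eq x y : (pclass x = pclass y) <-> rel_ideal (x - y).
Proof.
rewrite /pclass; split=> [/eqmodP|Ixy].
  by rewrite /= /Quotient.equiv => /rel_ideal_predP.
by apply/eqmodP; rewrite /= /Quotient.equiv; apply/rel_ideal_predP.
Qed.

Lemma pclassK (x : presented_alg) : pclass (repr (x : Q)) = x.
Proof. exact: reprK. Qed.

Lemma pclassB x y : pclass (x - y) = pclass x - pclass y.
Proof. exact: (raddfB (\pi_Q)). Qed.

Lemma pclassD x y : pclass (x + y) = pclass x + pclass y.
Proof. exact: (raddfD (\pi_Q)). Qed.

Definition pmul (x y : presented_alg) : presented_alg :=
  pclass (repr (x : Q) * repr (y : Q)).
Definition pscale (k : K) (x : presented_alg) : presented_alg :=
  pclass (k *: repr (x : Q)).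

Lemma repr_pclass x : rel_ideal (repr (pclass x : Q) - x).
Proof. by apply/pclass_eq; rewrite pclassK. Qed.

Lemma pmulE x y : pmul (pclass x) (pclass y) = pclass (x * y).
Proof.
apply/pclass_eq; set x' := repr _; set y' := repr _.
have -> : x' * y' - x * y = (x' - x) * y' + x * (y' - y).
  by rewrite mulrBl mulrBr addrA subrK.
by apply: rel_idealD; [apply: rel_idealMr|apply: rel_idealMl];
  apply: repr_pclass.
Qed.

Lemma pscaleE k x : pscale k (pclass x) = pclass (k *: x).
Proof.
apply/pclass_eq; rewrite -scalerBr -mul_malgC; apply: rel_idealMl.
exact: repr_pclass.
Qed.

Lemma pmulA : associative pmul.
Proof.
move=> x y z; rewrite -[x]pclassK -[y]pclassK -[z]pclassK.
by rewrite !pmulE mulrA.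
Qed.

Lemma pmul1 : left_id (pclass 1) pmul.
Proof. by move=> x; rewrite -[x]pclassK pmulE mul1r. Qed.

Lemma pmulr1 : right_id (pclass 1) pmul.
Proof. by move=> x; rewrite -[x]pclassK pmulE mulr1. Qed.

Lemma pmulDl : left_distributive pmul +%R.
Proof.
move=> x y z; rewrite -[x]pclassK -[y]pclassK -[z]pclassK.
by rewrite -pclassD !pmulE -pclassD mulrDl.
Qed.

Lemma pmulDr : right_distributive pmul +%R.
Proof.
move=> x y z; rewrite -[x]pclassK -[y]pclassK -[z]pclassK.
by rewrite -pclassD !pmulE -pclassD mulrDr.
Qed.

HB.instance Definition _ := GRing.Zmodule_isPzRing.Build presented_alg
  pmulA pmul1 pmulr1 pmulDl pmulDr.

Lemma pscaleA a b x : pscale a (pscale b x) = pscale (a * b) x.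
Proof. by rewrite -[x]pclassK !pscaleE scalerA. Qed.

Lemma pscale1 : left_id 1 pscale.
Proof. by move=> x; rewrite -[x]pclassK pscaleE scale1r. Qed.

Lemma pscaleDr : right_distributive pscale +%R.
Proof.
move=> a x y; rewrite -[x]pclassK -[y]pclassK -pclassD !pscaleE.
by rewrite -pclassD scalerDr.
Qed.

Lemma pscaleDl x : {morph pscale^~ x : a b / a + b}.
Proof. by move=> a b; rewrite -[x]pclassK !pscaleE -pclassD scalerDl. Qed.

HB.instance Definition _ := GRing.Zmodule_isLmodule.Build K presented_alg
  pscaleA pscale1 pscaleDr pscaleDl.

Lemma pclass1 : pclass 1 = 1.
Proof. exact: erefl. Qed.

Lemma pclassM x y : pclass (x * y) = pclass x * pclass y.
Proof. exact: esym (pmulE x y). Qed.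

Lemma pclassZ k x : pclass (k *: x) = k *: pclass x.
Proof. exact: esym (pscaleE k x). Qed.

Lemma pclass_rel l r : rel l r -> pclass l = pclass r.
Proof.
move=> lr; apply/pclass_eq; rewrite -[l - r]mul1r -[1 * _]mulr1.
exact: rel_ideal_gen.
Qed.

Lemma presented_scalerAl k (x y : presented_alg) : k *: (x * y) = (k *: x) * y.
Proof.
by rewrite -[x]pclassK -[y]pclassK -pclassM -!pclassZ -pclassM scalerAl.
Qed.

Lemma presented_scalerAr k (x y : presented_alg) : k *: (x * y) = x * (k *: y).
Proof.
rewrite -[x]pclassK -[y]pclassK -pclassM -!pclassZ -pclassM.
by rewrite -[in RHS]mul_malgC mulrA free_alg_mulC scalerAl.
Qed.

Definition pgen (x : X) : presented_alg := pclass (fgen K x).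

End PresentedAlgebra.
Arguments pgen {K X} rel x.

(* Extension of scalars K (x)_A B along f : A -> K of B = presented_alg rel:  *)
(* the generator [y] stands for 1 (x) y.  By [ext_mul] and [ext_one] every    *)
(* word in the generators equals a single [y], so the underlying K-module is  *)
(* the free one on B modulo [ext_add] and [ext_scale], with the product       *)
(* (a (x) y)(b (x) z) = ab (x) yz.                                            *)
Section ExtensionOfScalars.
Variables (A K : comNzRingType) (f : {rmorphism A -> K}) (X : choiceType).
Variable rel : free_alg A X -> free_alg A X -> Prop.
Local Notation B := (presented_alg rel).
Local Notation "[ y ]" := (fgen K (y : B)).

Inductive ext_rel : free_alg K B -> free_alg K B -> Prop :=
| ext_add y z : ext_rel [y + z] ([y] + [z])
| ext_scale a y : ext_rel [a *: y] (f a *: [y])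
| ext_one : ext_rel [1] 1
| ext_mul y z : ext_rel [y * z] ([y] * [z]).

Definition ext_scalars := presented_alg ext_rel.

Definition ext_incl (y : B) : ext_scalars := pgen ext_rel y.

End ExtensionOfScalars.

HB.instance Definition _ (A K : comNzRingType) (f : {rmorphism A -> K})
  (X : choiceType) (rel : free_alg A X -> free_alg A X -> Prop) :=
  GRing.PzRing.on (ext_scalars f rel).
HB.instance Definition _ (A K : comNzRingType) (f : {rmorphism A -> K})
  (X : choiceType) (rel : free_alg A X -> free_alg A X -> Prop) :=
  GRing.Lmodule.on (ext_scalars f rel).
Arguments ext_incl {A K} f {X rel} y.

Definition is_representation (K : fieldType) (X : choiceType)
    (rel : free_alg K X -> free_alg K X -> Prop) (V : vectType K)
    (rho : presented_alg rel -> 'End(V)) : Prop :=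
  [/\ linear rho, rho 1 = \1%VF
    & forall a b, rho (a * b) = (rho a \o rho b)%VF].

Notation ratfun C := {fraction {poly C}}.

#[local] Notation "x %:F" := (tofrac x).

Section LaurentPolynomials.
Variable C : fieldType.

Definition ratfunC (c : C) : ratfun C := (c%:P)%:F.
Definition ratfunX : ratfun C := ('X : {poly C})%:F.

Definition laurent_pred : {pred ratfun C} :=
  fun x => `[< exists (p : {poly C}) (m : nat), x = p%:F / ratfunX ^+ m >].

Lemma laurent_predP x :
  reflect (exists (p : {poly C}) (m : nat), x = p%:F / ratfunX ^+ m)
    (x \in laurent_pred).
Proof. exact: asboolP. Qed.

Lemma ratfunX_neq0 : ratfunX != 0.
Proof. by rewrite tofrac_eq0 polyX_eq0. Qed.

Lemma laurent_subring_closed : subring_closed laurent_pred.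
Proof.
have Xn0 m : ratfunX ^+ m != 0 by rewrite expf_neq0 ?ratfunX_neq0.
split.
- by apply/laurent_predP; exists 1, 0; rewrite tofrac1 divr1.
- move=> _ _ /laurent_predP[p [m ->]] /laurent_predP[r [k ->]].
  apply/laurent_predP; exists (p * 'X^k - r * 'X^m), (m + k)%N.
  rewrite tofracB !tofracM !tofracXn exprD mulrBl.
  rewrite -mulf_div divff ?mulr1 //; congr (_ - _).
  by rewrite [_ ^+ m * _]mulrC -mulf_div divff ?mulr1.
move=> _ _ /laurent_predP[p [m ->]] /laurent_predP[r [k ->]].
apply/laurent_predP; exists (p * r), (m + k)%N.
by rewrite tofracM exprD mulf_div.
Qed.
HB.instance Definition _ :=
  GRing.isSubringClosed.Build (ratfun C) laurent_pred laurent_subring_closed.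

(* C[q, q^-1], as the subring of C(q) of the fractions p(q) / q^m. *)
Record laurent := Laurent { laurent_val : ratfun C;
                            _ : laurent_val \in laurent_pred }.
HB.instance Definition _ := [isSub for laurent_val].
HB.instance Definition _ := [Choice of laurent by <:].
HB.instance Definition _ := [SubChoice_isSubComNzRing of laurent by <:].

Lemma laurentC_subproof (c : C) : ratfunC c \in laurent_pred.
Proof. by apply/laurent_predP; exists c%:P, 0; rewrite divr1. Qed.
Lemma laurentX_subproof : ratfunX \in laurent_pred.
Proof. by apply/laurent_predP; exists 'X, 0; rewrite divr1. Qed.
Lemma laurentV_subproof : ratfunX^-1 \in laurent_pred.
Proof. by apply/laurent_predP; exists 1, 1; rewrite tofrac1 div1r. Qed.

Definition laurentC (c : C) : laurent := Laurent (laurentC_subproof c).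
Definition laurentX : laurent := Laurent laurentX_subproof.
Definition laurentV : laurent := Laurent laurentV_subproof.

End LaurentPolynomials.
Arguments ratfunX {C}.
Arguments laurentX {C}.
Arguments laurentV {C}.

Lemma ord_next_subproof n (i : 'I_n.-1) : (i.+1 < n)%N.
Proof. by case: n i => [|n] [i ltin]. Qed.

(* Indices are 0-based: i : 'I_n.-1 stands for the pair (i, i+1) of           *)
(* consecutive elements [ord_this i] and [ord_next i] of 'I_n.                *)
Definition ord_this n (i : 'I_n.-1) : 'I_n := widen_ord (leq_pred n) i.
Definition ord_next n (i : 'I_n.-1) : 'I_n := Ordinal (ord_next_subproof i).
Definition simple_refl n (i : 'I_n.-1) : 'S_n := tperm (ord_this i) (ord_next i).

Section YokonumaHecke.
Variables (C : fieldType) (d n : nat).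

Definition YH_index : choiceType := ('I_n.-1 + 'I_n)%type.
Local Notation F := (free_alg (laurent C) YH_index).
Local Notation g i := (fgen (laurent C) (inl i : YH_index)).
Local Notation t j := (fgen (laurent C) (inr j : YH_index)).

(* As t_j^d = 1 in the algebra, t_j^-s is written t_j^(d - s) for s < d.      *)
Definition YH_e (i : 'I_n.-1) : F :=
  laurentC (d%:R^-1) *:
    \sum_(s < d) t (ord_this i) ^+ s * t (ord_next i) ^+ (d - s).

Inductive YH_rel : F -> F -> Prop :=
| YH_gg (i j : 'I_n.-1) : (i.+1 < j)%N || (j.+1 < i)%N ->
    YH_rel (g i * g j) (g j * g i)
| YH_braid (i j : 'I_n.-1) : j = i.+1 :> nat ->
    YH_rel (g i * g j * g i) (g j * g i * g j)
| YH_tt (i j : 'I_n) : YH_rel (t i * t j) (t j * t i)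
| YH_tg (j : 'I_n) (i : 'I_n.-1) :
    YH_rel (t j * g i) (g i * t (simple_refl i j))
| YH_td (j : 'I_n) : YH_rel (t j ^+ d) 1
| YH_quadratic (i : 'I_n.-1) :
    YH_rel (g i ^+ 2) (1 + (laurentX - laurentV) *: (YH_e i * g i)).

Definition YokonumaHecke := presented_alg YH_rel.

Local Notation incl := (val : {rmorphism laurent C -> ratfun C}).

Definition ratYokonumaHecke := ext_scalars incl YH_rel.

Definition YH_g (i : 'I_n.-1) : ratYokonumaHecke :=
  ext_incl incl (pgen YH_rel (inl i)).
Definition YH_t (j : 'I_n) : ratYokonumaHecke :=
  ext_incl incl (pgen YH_rel (inr j)).

End YokonumaHecke.

Definition is_partition (s : seq nat) : bool :=
  sorted geq s && (0%N \notin s).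

Record dpartition d n := DPartition {
  dpart : d.-tuple (seq nat);
  dpartP : all is_partition dpart /\ (\sum_(k < d) sumn (tnth dpart k) = n)%N
}.

Section Tableaux.
Variables (d n : nat) (la : dpartition d n).

(* A node (x, y, k): row x, column y (both 0-based), position k.  Rows and    *)
(* columns of a d-partition of n are < n, so 'I_n suffices to index them.     *)
Definition dnode := ('I_n * 'I_n * 'I_d)%type.
Definition node_row (th : dnode) : nat := th.1.1.
Definition node_col (th : dnode) : nat := th.1.2.
Definition node_pos (th : dnode) : 'I_d := th.2.

Definition dnodes : {set dnode} :=
  [set th | (node_col th < nth 0%N (tnth (dpart la) (node_pos th)) (node_row th))%N].

Definition is_dtableau (T : {ffun 'I_n -> dnode}) : bool :=
  injectiveb T && ([set T i | i : 'I_n] == dnodes).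

(* A tableau is recorded as the bijection sending each entry to its node. *)
Record dtableau := DTableau {
  dtableau_fun :> {ffun 'I_n -> dnode};
  dtableauP : is_dtableau dtableau_fun
}.
HB.instance Definition _ := [isSub for dtableau_fun].
HB.instance Definition _ := [Finite of dtableau by <:].

Definition standard (T : dtableau) : bool :=
  [forall i : 'I_n, forall j : 'I_n,
    (node_pos (T i) == node_pos (T j)) ==>
    (((node_row (T i) == node_row (T j)) && (node_col (T i) < node_col (T j)))
     || ((node_col (T i) == node_col (T j)) && (node_row (T i) < node_row (T j))))%N
    ==> (i < j)%N].

Lemma dtableau_perm_subproof (sigma : 'S_n) (T : dtableau) :
  is_dtableau [ffun i => T (sigma^-1%g i)].
Proof.
have /andP[/injectiveP injT /eqP imT] := dtableauP T.
apply/andP; split.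
  by apply/injectiveP => i j; rewrite !ffunE => /injT /perm_inj.
rewrite -imT; apply/eqP/setP => th; apply/imsetP/imsetP => -[i _ ->].
  by exists (sigma^-1%g i); rewrite ?ffunE.
by exists (sigma i); rewrite ?ffunE ?permK.
Qed.

(* T^sigma has sigma(i) in the node where T has i. *)
Definition dtableau_perm (sigma : 'S_n) (T : dtableau) : dtableau :=
  DTableau (dtableau_perm_subproof sigma T).

Definition tab_pos (T : dtableau) (i : 'I_n) : 'I_d := node_pos (T i).

Definition tab_content (C : fieldType) (T : dtableau) (i : 'I_n) : ratfun C :=
  ratfunX ^ (2 * ((node_col (T i))%:Z - (node_row (T i))%:Z)).

End Tableaux.
Arguments standard {d n la}.
Arguments tab_content {d n la} C T i.

(* Main.v *)
From HB Require Import structures.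
Require Import Defs.
From mathcomp Require Import all_boot all_order all_algebra.
From mathcomp Require Import perm fraction ring_quotient generic_quotient.
From mathcomp Require Import monalg complex reals.
From mathcomp Require Import zify ring.

Set Implicit Arguments.
Unset Strict Implicit.
Unset Printing Implicit Defensive.

Import GRing.Theory.
Local Open Scope ring_scope.

(** The task is to find operators on V, one for each generator, that satisfy
    the defining relations. Both the Yokonuma-Hecke algebra and its extension
    of scalars are given by generators and relations, so such operators extend
    to a representation; this is [ext_scalars_lift].

    The operator T_j is diagonal in the basis of standard tableaux. The
    operator G_i mixes v_T and v_(T^s_i) with two coefficients that depend only
    on the nodes A and B where T has i and i+1. Applied to v_T and compared on
    the vectors v_(T^w), every relation thus becomes an identity between
    rational functions of at most three contents: [coef_quadratic] and
    [diag_coefC] for the quadratic relation, [diag_coef_braid],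
    [diag_coef_yb] and [diag_coef_yb_rev] for the braid relation. The
    idempotent e_i acts as the projection onto the span of the v_T for which i
    and i+1 have the same position ([sum_root_powers], [ev_e]).

    Two things must be controlled because only standard tableaux carry a basis
    vector.

    - Denominators. Two entries of a standard tableau lying on the same
      diagonal of the same diagram differ by at least 3
      ([standard_diag_gap]), so the contents of the nodes of i, i+1, i+2 that
      share a diagram are distinct.

    - Vanishing vectors. To expand a word in the G_i, the formula for
      G_i v_T should also hold when T is not standard, that is when v_T = 0.
      With the given coefficients it fails when T^s_i is standard with i+1
      just below i. But whenever i and i+1 lie in the same row or column of
      the same diagram of a standard T, the vector v_(T^s_i) is zero, so the
      second coefficient may be replaced by 0 for all such pairs of nodes. This
      is [off_coef]: the operators are the same ([opG_same_pos]), and the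
      formula now holds for all tableaux ([opGE]). The identities survive,
      since the modified coefficients enter them only as common factors and
      through the products off A B * off B A; these products do not change, as
      the contents of two adjacent nodes differ by a factor q^2 or q^-2, for
      which one of the original factors is zero ([off_coef_prod]). *)

(** * Universal property of presented algebras *)

Section FreeAlgebraEval.
Variables (K : comNzRingType) (X : choiceType) (S : nzRingType).
Variables (f : {rmorphism K -> S}) (h : X -> S).
Hypothesis f_central : forall c s, f c * s = s * f c.

Definition word_eval (m : {fmonom X}) : S := \prod_(x <- (m : seq X)) h x.

Lemma word_eval_morphism : mmorphism word_eval.
Proof.
split=> [m1 m2|]; last by rewrite /word_eval fm1 big_nil.
by rewrite /word_eval -big_cat fmM.
Qed.
HB.instance Definition _ :=
  isMultiplicative.Build {fmonom X} S word_eval word_eval_morphism.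

Definition free_eval : free_alg K X -> S := mmap f word_eval.

Lemma free_eval_additive : zmod_morphism free_eval.
Proof. exact: mmap_is_additive. Qed.
HB.instance Definition _ :=
  GRing.isZmodMorphism.Build (free_alg K X) S free_eval free_eval_additive.

Lemma free_eval_multiplicative : monoid_morphism free_eval.
Proof.
have [] := commr_mmap_is_multiplicative (f := f) (h := word_eval).
  by move=> g m m'; apply: f_central.
by [].
Qed.
Lemma free_evalZ c x : free_eval (c *: x) = f c * free_eval x.
Proof. exact: mmapZ. Qed.

Lemma free_eval_gen x : free_eval (fgen K x) = h x.
Proof. by rewrite /free_eval mmapU /= rmorph1 mul1r /word_eval fmuE big_seq1. Qed.
End FreeAlgebraEval.

Section PresentedLift.
Variables (K : comNzRingType) (X : choiceType) (S : nzRingType).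
Variables (f : {rmorphism K -> S}) (h : X -> S).
Hypothesis f_central : forall c s, f c * s = s * f c.
Variable rel : free_alg K X -> free_alg K X -> Prop.
Hypothesis rel_eval : forall l r, rel l r -> free_eval f h l = free_eval f h r.

(** The evaluation of the free algebra at h kills the ideal of the relations,
    so evaluating any representative of a class is well defined. *)
Lemma presented_lift :
  exists F : presented_alg rel -> S,
    [/\ {morph F : x y / x + y}, monoid_morphism F,
        forall c x, F (c *: x) = f c * F x & forall x, F (pgen rel x) = h x].
Proof.
pose ev := free_eval f h.
have evM x y : ev (x * y) = ev x * ev y.
  by have [_] := free_eval_multiplicative h f_central; apply.
have evD x y : ev (x + y) = ev x + ev y by exact: (raddfD (free_eval f h)).
have evB x y : ev (x - y) = ev x - ev y by exact: (raddfB (free_eval f h)).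
have ev_ideal x : rel_ideal rel x -> ev x = 0.
  elim=> [u w l r /rel_eval Elr||y z _ ey _ ez].
  - by rewrite !evM evB /ev Elr subrr mulr0 mul0r.
  - exact: (raddf0 (free_eval f h)).
  - by rewrite evD ey ez addr0.
pose F (x : presented_alg rel) :=
  ev (repr (x : Quotient.quot (rel_ideal_pred rel))).
have FE x : F (pclass rel x) = ev x.
  by apply/eqP; rewrite -subr_eq0 -evB (ev_ideal _ (repr_pclass _ _)).
exists F; split=> [x y||c x|x]; last by rewrite FE /ev free_eval_gen.
- by rewrite -[x]pclassK -[y]pclassK -pclassD !FE evD.
- split=> [|x y].
    by rewrite -pclass1 FE; apply: (free_eval_multiplicative h f_central).1.
  by rewrite -[x]pclassK -[y]pclassK -pclassM !FE evM.
- by rewrite -[x]pclassK -pclassZ !FE /ev free_evalZ.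
Qed.
End PresentedLift.

Section ExtLift.
Variables (A K : comNzRingType) (i : {rmorphism A -> K}) (X : choiceType).
Variable rel : free_alg A X -> free_alg A X -> Prop.
Variables (S : nzRingType) (f : {rmorphism K -> S}) (h : X -> S).
Hypothesis f_central : forall c s, f c * s = s * f c.
Hypothesis rel_eval :
  forall l r, rel l r -> free_eval (f \o i) h l = free_eval (f \o i) h r.

(** A map F1 on the algebra over A comes from the relations over A; F1 in turn
    respects the relations that define the extension of scalars, whose
    generators are all the elements of the algebra over A. *)
Lemma ext_scalars_lift :
  exists F : presented_alg (ext_rel i (rel := rel)) -> S,
    [/\ {morph F : x y / x + y}, monoid_morphism F,
        forall c x, F (c *: x) = f c * F x
      & forall x, F (ext_incl i (pgen rel x)) = h x].
Proof.
have fi_central c s : (f \o i) c * s = s * (f \o i) c by exact: f_central.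
have [F1 [F1D [F11 F1M] F1Z F1g]] := presented_lift fi_central rel_eval.
pose ev := free_eval f (F1 : presented_alg rel -> S).
have [ev1 evM] :=
  free_eval_multiplicative (F1 : presented_alg rel -> S) f_central.
have ext_eval l r : ext_rel i (rel := rel) l r -> ev l = ev r.
  case=> [y z|a y||y z].
  - by rewrite /ev (raddfD (free_eval f F1)) /= !free_eval_gen F1D.
  - by rewrite /ev free_evalZ !free_eval_gen F1Z.
  - by rewrite /ev ev1 free_eval_gen F11.
  - by rewrite /ev evM !free_eval_gen F1M.
have [F [FD FM FZ Fg]] := presented_lift f_central ext_eval.
by exists F; split=> // x; rewrite -F1g; apply: Fg.
Qed.
End ExtLift.

(** * Standard tableaux *)

Section StandardTableaux.
Variables (d n : nat) (la : dpartition d n).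
Implicit Types (T : dtableau la) (A B : dnode d n).

(** The quantum content of A is q to the power twice this number. *)
Definition node_diag A : int := (node_col A)%:Z - (node_row A)%:Z.

Definition collinear A B : bool :=
  (node_row A == node_row B) || (node_col A == node_col B).

Lemma collinearC A B : collinear A B = collinear B A.
Proof. by rewrite /collinear eq_sym [node_col A == _]eq_sym. Qed.

Lemma node_eqP A B : node_pos A = node_pos B -> node_row A = node_row B ->
  node_col A = node_col B -> A = B.
Proof.
case: A B => [[x y] k] [[x' y'] k']; rewrite /node_pos /node_row /node_col /=.
by move=> -> /val_inj-> /val_inj->.
Qed.

Lemma dnodes_down A B : A \in dnodes la -> node_pos B = node_pos A ->
  (node_row B <= node_row A)%N -> (node_col B <= node_col A)%N ->
  B \in dnodes la.
Proof.
rewrite !inE => Ala -> rBA cBA; apply: leq_ltn_trans cBA (leq_trans Ala _).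
have [/all_tnthP/(_ (node_pos A))/andP[sorted_la _] _] := dpartP la.
set s := tnth _ _ in sorted_la *.
have [ltA|leA] := ltnP (node_row A) (size s); last by rewrite nth_default.
have geq_trans : transitive geq by move=> y x z xy yz; apply: leq_trans yz xy.
apply: (sorted_leq_nth geq_trans (fun x => leqnn x) 0%N sorted_la) => //.
by rewrite inE (leq_ltn_trans rBA).
Qed.

Lemma tableau_inj T : injective T.
Proof. by have /andP[/injectiveP] := dtableauP T. Qed.

Lemma tableau_mem T i : T i \in dnodes la.
Proof.
by have /andP[_ /eqP<-] := dtableauP T; apply/imsetP; exists i.
Qed.

Lemma tableau_entry T A : A \in dnodes la -> exists m, T m = A.
Proof.
by have /andP[_ /eqP<-] := dtableauP T; case/imsetP=> m _ ->; exists m.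
Qed.

Lemma standard_row T i j : standard T ->
  node_pos (T i) = node_pos (T j) -> node_row (T i) = node_row (T j) ->
  (node_col (T i) < node_col (T j))%N -> (i < j)%N.
Proof.
move=> /forallP/(_ i)/forallP/(_ j) Tij pij rij cij.
by move: Tij; rewrite pij rij cij !eqxx.
Qed.

Lemma standard_col T i j : standard T ->
  node_pos (T i) = node_pos (T j) -> node_col (T i) = node_col (T j) ->
  (node_row (T i) < node_row (T j))%N -> (i < j)%N.
Proof.
move=> /forallP/(_ i)/forallP/(_ j) Tij pij cij rij.
by move: Tij; rewrite pij cij rij !eqxx /= orbT.
Qed.

(** The two witnesses are the entries at the two other corners of the rectangle
    spanned by the nodes of i and j, which lie in the diagram. *)
Lemma standard_corner T i j : standard T ->
    node_pos (T i) = node_pos (T j) ->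
    (node_row (T i) < node_row (T j))%N -> (node_col (T i) < node_col (T j))%N ->
  exists a b : 'I_n, [/\ a != b, (i < a < j)%N & (i < b < j)%N].
Proof.
move=> sT pij rij cij.
have corner (x y : 'I_n) : (x <= node_row (T j))%N -> (y <= node_col (T j))%N ->
    exists m, T m = (x, y, node_pos (T j)).
  by move=> lex ley; apply/tableau_entry/(dnodes_down (tableau_mem T j)).
have [a Ta] := corner (T i).1.1 (T j).1.2 (ltnW rij) (leqnn _).
have [b Tb] := corner (T j).1.1 (T i).1.2 (leqnn _) (ltnW cij).
exists a, b; split.
- apply: contraTneq rij => ab; move: Tb.
  by rewrite -ab Ta => -[] /(congr1 val) /= E _; rewrite /node_row -E ltnn.
- rewrite (standard_row sT) ?Ta //= (standard_col sT) ?Ta //=.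
- by rewrite (standard_col sT) ?Tb //= (standard_row sT) ?Tb.
Qed.

(** Distinct nodes on a diagonal are opposite corners of a square, and the
    entries at its two other corners lie strictly between i and j. This keeps
    the contents apart in the quadratic and braid relations. *)
Lemma standard_diag_gap T i j : standard T ->
  node_pos (T i) = node_pos (T j) -> node_diag (T i) = node_diag (T j) ->
  (i < j)%N -> (i.+2 < j)%N.
Proof.
move=> sT pij; rewrite /node_diag => dij ltij.
have [rij|rji|rij] := ltngtP (node_row (T i)) (node_row (T j)).
- have cij : (node_col (T i) < node_col (T j))%N by lia.
  have [a [b []]] := standard_corner sT pij rij cij.
  by rewrite -(inj_eq val_inj) /=; lia.
- have cji : (node_col (T j) < node_col (T i))%N by lia.
  have [a [b []]] := standard_corner sT (esym pij) rji cji.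
  by rewrite -(inj_eq val_inj) /=; lia.
have /tableau_inj E : T i = T j by apply: node_eqP => //; lia.
by rewrite E ltnn in ltij.
Qed.

(** A node strictly between those of i and i+1 in their row or column would
    have to carry an entry strictly between i and i+1, so the two nodes are
    adjacent. *)
Lemma standard_collinear_diag T (i j : 'I_n) : standard T -> j = i.+1 :> nat ->
  node_pos (T i) = node_pos (T j) -> collinear (T i) (T j) ->
  node_diag (T j) = node_diag (T i) + 1 \/ node_diag (T j) = node_diag (T i) - 1.
Proof.
move=> sT ji pij; rewrite /node_diag => /orP[/eqP rij|/eqP cij].
- left; rewrite rij.
  have [cij|cji|cij] := ltngtP (node_col (T i)) (node_col (T j)).
  + suff -> : node_col (T j) = (node_col (T i)).+1 by lia.
    apply/eqP; rewrite eqn_leq cij andbT leqNgt; apply/negP => gap.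
    have ltn : ((node_col (T i)).+1 < n)%N := ltn_trans gap (ltn_ord _).
    have [|m Tm] := @tableau_entry T ((T j).1.1, Ordinal ltn, node_pos (T j)).
      by apply: (dnodes_down (tableau_mem T j)) => //=; apply: ltnW.
    have im : (i < m)%N by rewrite (standard_row sT) ?Tm.
    have mj : (m < j)%N by rewrite (standard_row sT) ?Tm.
    by lia.
  + by have := standard_row sT (esym pij) (esym rij) cji; lia.
  + have /tableau_inj E : T i = T j by apply: node_eqP.
    by move: ji; rewrite E; lia.
- right; rewrite cij.
  have [rij|rji|rij] := ltngtP (node_row (T i)) (node_row (T j)).
  + suff -> : node_row (T j) = (node_row (T i)).+1 by lia.
    apply/eqP; rewrite eqn_leq rij andbT leqNgt; apply/negP => gap.
    have ltn : ((node_row (T i)).+1 < n)%N := ltn_trans gap (ltn_ord _).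
    have [|m Tm] := @tableau_entry T (Ordinal ltn, (T j).1.2, node_pos (T j)).
      by apply: (dnodes_down (tableau_mem T j)) => //=; apply: ltnW.
    have im : (i < m)%N by rewrite (standard_col sT) ?Tm.
    have mj : (m < j)%N by rewrite (standard_col sT) ?Tm.
    by lia.
  + by have := standard_col sT (esym pij) (esym cij) rji; lia.
  + have /tableau_inj E : T i = T j by apply: node_eqP.
    by move: ji; rewrite E; lia.
Qed.

Definition tab_swap (i : 'I_n.-1) T := dtableau_perm (simple_refl i) T.

Lemma tab_swapE i T k : tab_swap i T k = T (simple_refl i k).
Proof. by rewrite ffunE /simple_refl tpermV. Qed.

Lemma tab_swap_this i T : tab_swap i T (ord_this i) = T (ord_next i).
Proof. by rewrite tab_swapE tpermL. Qed.

Lemma tab_swap_next i T : tab_swap i T (ord_next i) = T (ord_this i).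
Proof. by rewrite tab_swapE tpermR. Qed.

Lemma tab_eqP T T' : T =1 T' -> T = T'.
Proof. by move=> E; apply/val_inj/ffunP. Qed.

Lemma tab_swapK i : involutive (tab_swap i).
Proof. by move=> T; apply: tab_eqP => k; rewrite !tab_swapE tpermK. Qed.

Lemma swap_collinear i T : standard T ->
    node_pos (T (ord_this i)) = node_pos (T (ord_next i)) ->
    collinear (T (ord_this i)) (T (ord_next i)) ->
  ~~ standard (tab_swap i T).
Proof.
move=> sT pij col; apply/negP => sTs.
have lt_ni : (ord_next i < ord_this i)%N -> False by rewrite /=; lia.
case/orP: col => /eqP E.
- have [cij|cji|cij] :=
    ltngtP (node_col (T (ord_this i))) (node_col (T (ord_next i))).
  + apply: lt_ni; apply: (standard_row sTs);
      by rewrite ?tab_swap_this ?tab_swap_next.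
  + by apply: lt_ni; apply: (standard_row sT).
  + have /tableau_inj/(congr1 val) /= := node_eqP pij E cij; lia.
- have [rij|rji|rij] :=
    ltngtP (node_row (T (ord_this i))) (node_row (T (ord_next i))).
  + apply: lt_ni; apply: (standard_col sTs);
      by rewrite ?tab_swap_this ?tab_swap_next.
  + by apply: lt_ni; apply: (standard_col sT).
  + have /tableau_inj/(congr1 val) /= := node_eqP pij rij E; lia.
Qed.

(** Exchanging i and i+1 affects only their mutual order, which is
    constrained by standardness just when their nodes share a row or a
    column. *)
Lemma swap_standard i T : standard T ->
    ~~ ((node_pos (T (ord_this i)) == node_pos (T (ord_next i)))
        && collinear (T (ord_this i)) (T (ord_next i))) ->
  standard (tab_swap i T).
Proof.
move=> sT ncol; apply/forallP => a; apply/forallP => b.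
apply/implyP; rewrite !tab_swapE => pab; apply/implyP => before.
have lt_s : (simple_refl i a < simple_refl i b)%N.
  by have /forallP/(_ (simple_refl i a))/forallP/(_ (simple_refl i b)) := sT;
    rewrite pab before.
have {}ncol : ~ (simple_refl i a = ord_this i /\ simple_refl i b = ord_next i).
  case=> Ea Eb; move: ncol; rewrite -Ea -Eb pab /collinear /=.
  by case/orP: before => /andP[-> _]; rewrite ?orbT.
move: lt_s ncol; rewrite /simple_refl.
case: tpermP => [->|->|/eqP + /eqP]; case: tpermP => [->|->|/eqP + /eqP] => //=;
  rewrite -?(inj_eq val_inj) /=; try lia.
by move=> _ ncol; case: ncol.
Qed.

Lemma simple_refl_far (i j : 'I_n.-1) : (i.+1 < j)%N || (j.+1 < i)%N ->
  (simple_refl i (ord_this j) = ord_this j)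
  * (simple_refl i (ord_next j) = ord_next j).
Proof.
by move=> ij; rewrite /simple_refl !tpermD // -(inj_eq val_inj) /=; lia.
Qed.

Lemma tab_swapC (i j : 'I_n.-1) T : (i.+1 < j)%N || (j.+1 < i)%N ->
  tab_swap i (tab_swap j T) = tab_swap j (tab_swap i T).
Proof.
move=> far; apply: tab_eqP => k.
rewrite !tab_swapE -!permM; congr (T (fun_of_perm _ k)).
by rewrite [RHS]conjgC {2}/simple_refl tpermJ !simple_refl_far.
Qed.

(** Both sides are the transposition of i and i+2, obtained by conjugating one
    of the simple transpositions by the other. *)
Lemma tab_swap_braid (i j : 'I_n.-1) T : j = i.+1 :> nat ->
  tab_swap i (tab_swap j (tab_swap i T)) = tab_swap j (tab_swap i (tab_swap j T)).
Proof.
move=> ji; have ni : ord_next i = ord_this j by apply: val_inj.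
have ne (a b : 'I_n) : a != b :> nat -> a != b by rewrite (inj_eq val_inj).
apply: tab_eqP => k; rewrite !tab_swapE -!permM; congr (T (fun_of_perm _ k)).
transitivity (simple_refl j ^ simple_refl i)%g.
  by rewrite conjgE /simple_refl tpermV mulgA.
transitivity (simple_refl i ^ simple_refl j)%g; last first.
  by rewrite conjgE /simple_refl tpermV mulgA.
rewrite {1}/simple_refl [in RHS]/simple_refl !tpermJ /simple_refl -ni.
rewrite tpermR tpermL.
by rewrite !tpermD //; apply: ne => /=; lia.
Qed.
End StandardTableaux.

(** * Rational identities between the coefficients *)

Section HeckeCoefficients.
Variable F : fieldType.
Implicit Types q a b e : F.

Definition hecke_diag q a b : F := b * (q - q^-1) / (b - a).
Definition hecke_off q a b : F := (q * b - q^-1 * a) / (b - a).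

Lemma neq_subC a b : b - a != 0 -> a - b != 0.
Proof. by rewrite -opprB oppr_eq0. Qed.

(** Among two adjacent nodes, this is the direction in which the off-diagonal
    coefficient vanishes: the second content is the first divided by q^2. *)
Lemma hecke_off_succ q a : q != 0 -> hecke_off q (a * (q * q)) a = 0.
Proof.
by move=> q0; rewrite /hecke_off (mulrC a) !mulrA mulVf // mul1r subrr mul0r.
Qed.

Lemma hecke_diagC q a b : b - a != 0 ->
  hecke_diag q a b + hecke_diag q b a = q - q^-1.
Proof.
move=> ab; have ba := neq_subC ab.
rewrite /hecke_diag; move: (q^-1) => p; field.
by rewrite ab ba.
Qed.

Lemma hecke_quadratic q a b : q != 0 -> b - a != 0 ->
  hecke_diag q a b ^+ 2 + hecke_off q a b * hecke_off q b a
    = 1 + (q - q^-1) * hecke_diag q a b.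
Proof.
move=> q0 ab; have ba := neq_subC ab; rewrite /hecke_diag /hecke_off.
by field; rewrite ab ba q0.
Qed.

(** Comparing in the braid relation the coefficients of the tableau in which i
    and i+1 have been exchanged gives this identity, up to a common factor; the
    next one is its mirror image for i+1 and i+2. *)
Lemma hecke_yb q a b e : q != 0 -> b - a != 0 -> e - b != 0 -> e - a != 0 ->
  hecke_diag q a b * hecke_diag q b e + hecke_diag q a e * hecke_diag q b a
    = hecke_diag q b e * hecke_diag q a e.
Proof.
move=> q0 ab be ae; have ba := neq_subC ab; rewrite /hecke_diag.
by field; rewrite ab ba be ae q0.
Qed.

Lemma hecke_yb_rev q a b e : q != 0 -> b - a != 0 -> e - b != 0 -> e - a != 0 ->
  hecke_diag q a b * hecke_diag q b e + hecke_diag q a e * hecke_diag q e b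
    = hecke_diag q a b * hecke_diag q a e.
Proof.
move=> q0 ab be ae; have eb := neq_subC be; rewrite /hecke_diag.
by field; rewrite ab be eb ae q0.
Qed.

Lemma hecke_braid q a b e : q != 0 -> b - a != 0 -> e - b != 0 -> e - a != 0 ->
  hecke_diag q a b ^+ 2 * hecke_diag q b e
      + hecke_off q a b * hecke_off q b a * hecke_diag q a e
    = hecke_diag q b e ^+ 2 * hecke_diag q a b
      + hecke_off q b e * hecke_off q e b * hecke_diag q a e.
Proof.
move=> q0 ab be ae; have ba := neq_subC ab; have eb := neq_subC be.
rewrite /hecke_diag /hecke_off.
by field; rewrite ab ba be eb ae q0.
Qed.
End HeckeCoefficients.

Section Coefficients.
Variables (K : fieldType) (q : K) (d n : nat).
Hypotheses (q0 : q != 0) (q_exp_inj : injective (fun m : int => q ^ m)).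
Implicit Types A B D : dnode d n.
Local Notation content A := (q ^ (2 * node_diag A)).
Local Notation same_pos A B := (node_pos A == node_pos B).

Definition diag_coef A B : K :=
  if same_pos A B then hecke_diag q (content A) (content B) else 0.

(** For collinear nodes the value 0 replaces the coefficient of the seminormal
    formula, so that a nonstandard tableau is never sent to a standard one. *)
Definition off_coef A B : K :=
  if same_pos A B then
    if collinear A B then 0 else hecke_off q (content A) (content B)
  else 1.

Definition separated A B :=
  node_pos A = node_pos B -> node_diag A <> node_diag B.

Definition adjacent_if_collinear A B :=
  node_pos A = node_pos B -> collinear A B ->
  node_diag B = node_diag A + 1 \/ node_diag B = node_diag A - 1.

Lemma separated_sub A B : separated A B -> same_pos A B ->
  content B - content A != 0.
Proof.
move=> sAB /eqP/sAB dAB; rewrite subr_eq0; apply/eqP => /q_exp_inj; lia.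
Qed.

Lemma content_succ A B : node_diag B = node_diag A + 1 ->
  content B = content A * (q * q).
Proof. by move->; rewrite mulrDr expfzDr ?q0. Qed.

(** For collinear nodes both sides vanish: the contents differ by a factor q^2
    in one direction or the other, and one of the two factors on the right is
    then zero. *)
Lemma off_coef_prod A B : separated A B -> adjacent_if_collinear A B ->
  off_coef A B * off_coef B A = if same_pos A B then
    hecke_off q (content A) (content B) * hecke_off q (content B) (content A)
  else 1.
Proof.
move=> sAB cAB; rewrite /off_coef [node_pos B == _]eq_sym.
rewrite [collinear B A]collinearC.
case: ifP => [pAB|_]; last by rewrite mulr1.
case: ifP => // col; rewrite mul0r.
have [E|E] := cAB (eqP pAB) col.
- by rewrite (content_succ E) hecke_off_succ ?mulr0.
- have {}E : node_diag A = node_diag B + 1 by lia.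
  by rewrite (content_succ E) hecke_off_succ ?mul0r.
Qed.

Lemma diag_coefC A B : separated A B ->
  diag_coef A B + diag_coef B A = if same_pos A B then q - q^-1 else 0.
Proof.
move=> sAB; rewrite /diag_coef [node_pos B == _]eq_sym.
case: ifP => [p|_]; last by rewrite addr0.
exact/hecke_diagC/separated_sub.
Qed.

Lemma coef_quadratic A B : separated A B -> adjacent_if_collinear A B ->
  diag_coef A B ^+ 2 + off_coef A B * off_coef B A
    = 1 + (if same_pos A B then (q - q^-1) * diag_coef A B else 0).
Proof.
move=> sAB cAB; rewrite off_coef_prod // /diag_coef.
case: ifP => [p|_]; last by rewrite expr0n add0r addr0.
by apply: hecke_quadratic; [apply: q0|apply: separated_sub].
Qed.

Lemma diag_coef_yb A B D :
    separated A B -> separated B D -> separated A D ->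
  diag_coef A B * diag_coef B D + diag_coef A D * diag_coef B A
    = diag_coef B D * diag_coef A D.
Proof.
move=> sAB sBD sAD; rewrite /diag_coef [node_pos B == node_pos A]eq_sym.
case: ifP => [pAB|nAB]; case: ifP => [pBD|nBD]; case: ifP => [pAD|nAD];
  rewrite ?mulr0 ?mul0r ?addr0 ?add0r //.
- by apply: hecke_yb; rewrite ?q0 ?separated_sub.
- by move: nAD; rewrite (eqP pAB) pBD.
- by move: nBD; rewrite -(eqP pAB) pAD.
- by move: nAB; rewrite (eqP pAD) eq_sym pBD.
Qed.

Lemma diag_coef_yb_rev A B D :
    separated A B -> separated B D -> separated A D ->
  diag_coef A B * diag_coef B D + diag_coef A D * diag_coef D B
    = diag_coef A B * diag_coef A D.
Proof.
move=> sAB sBD sAD; rewrite /diag_coef [node_pos D == node_pos B]eq_sym.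
case: ifP => [pAB|nAB]; case: ifP => [pBD|nBD]; case: ifP => [pAD|nAD];
  rewrite ?mulr0 ?mul0r ?addr0 ?add0r //.
- by apply: hecke_yb_rev; rewrite ?q0 ?separated_sub.
- by move: nAD; rewrite (eqP pAB) pBD.
- by move: nBD; rewrite -(eqP pAB) pAD.
- by move: nAB; rewrite (eqP pAD) eq_sym pBD.
Qed.

(** Coefficient of the starting tableau in the braid relation. When the three
    positions are not all equal, at most one of the diagonal coefficients is
    nonzero and the identity is immediate. *)
Lemma diag_coef_braid A B D :
    separated A B -> separated B D -> separated A D ->
    adjacent_if_collinear A B -> adjacent_if_collinear B D ->
  diag_coef A B ^+ 2 * diag_coef B D
      + off_coef A B * off_coef B A * diag_coef A D
    = diag_coef B D ^+ 2 * diag_coef A B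
      + off_coef B D * off_coef D B * diag_coef A D.
Proof.
move=> sAB sBD sAD cAB cBD; rewrite !off_coef_prod // /diag_coef.
case: ifP => [pAB|nAB]; case: ifP => [pBD|nBD]; case: ifP => [pAD|nAD];
  rewrite ?expr0n ?mulr0 ?mul0r ?mul1r ?addr0 ?add0r //.
- by apply: hecke_braid; rewrite ?q0 ?separated_sub.
- by move: nAD; rewrite (eqP pAB) pBD.
- by move: nBD; rewrite -(eqP pAB) pAD.
- by move: nAB; rewrite (eqP pAD) eq_sym pBD.
Qed.
End Coefficients.

(** * The operators and their relations *)

(** Linear forms turn an identity between combinations of vectors into a ring
    identity. *)
Lemma vect_scalarP (K : fieldType) (V : vectType K) (x y : V) :
  (forall phi : {scalar V}, phi x = phi y) -> x = y.
Proof.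
move=> xy; rewrite [x](coord_vbasis (memvf x)) [y](coord_vbasis (memvf y)).
by apply: eq_bigr => k _; rewrite (xy (coord (vbasis fullv) k)).
Qed.

Section Seminormal.
Variables (K : fieldType) (q : K) (d n : nat) (la : dpartition d n).
Hypotheses (q0 : q != 0) (q_exp_inj : injective (fun m : int => q ^ m)).
Variables (V : vectType K) (v : dtableau la -> V).
Hypothesis v_basis : basis_of {:V} [seq v T | T in standard].
Hypothesis v_nonstandard : forall T : dtableau la, ~~ standard T -> v T = 0.
Variable zeta : 'I_d -> K.
Implicit Types (T : dtableau la) (i : 'I_n.-1) (j : 'I_n).

Definition tab_lfun (u : dtableau la -> V) : 'End(V) :=
  linfun (sval (linear_of_free [seq v T | T in standard]
                               [seq u T | T in standard])).

Lemma tab_lfunE u T : standard T -> tab_lfun u (v T) = u T.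
Proof.
move=> sT; rewrite lfunE /=; case: linear_of_free => f /= fE.
have {fE} := fE (basis_free v_basis); rewrite !size_map => /(_ erefl).
by rewrite -map_comp => /eq_in_map/(_ T); apply; rewrite mem_enum.
Qed.

Lemma lfun_tabP (f g : 'End(V)) :
  (forall T, standard T -> f (v T) = g (v T)) -> f = g.
Proof.
move=> fg; apply/lfunP => x; have : x \in <<[seq v T | T in standard]>>%VS.
  by rewrite (span_basis v_basis) memvf.
move/(coord_span (X := in_tuple _))->; rewrite !linear_sum.
apply: eq_bigr => k _; rewrite !linearZ /=; congr (_ *: _).
have /mapP[T sT ->] := mem_nth 0 (ltn_ord k : (k < size (in_tuple _))%N).
by apply: fg; rewrite mem_enum in sT.
Qed.

Local Notation dg T i := (diag_coef q (T (ord_this i)) (T (ord_next i))).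
Local Notation off T i := (off_coef q (T (ord_this i)) (T (ord_next i))).

Definition opG i : 'End(V) :=
  tab_lfun (fun T => dg T i *: v T + off T i *: v (tab_swap i T)).
Definition opT j : 'End(V) := tab_lfun (fun T => zeta (tab_pos T j) *: v T).

Lemma opTE j T : opT j (v T) = zeta (tab_pos T j) *: v T.
Proof.
have [sT|nT] := boolP (standard T); first by rewrite tab_lfunE.
by rewrite v_nonstandard // linear0 scaler0.
Qed.

(** For T nonstandard, the left-hand side is zero; so is the right-hand side,
    because either the exchanged tableau is nonstandard as well, or T arises
    from a standard tableau whose entries i and i+1 are collinear, and then the
    modified coefficient is zero. *)
Lemma opGE i T :
  opG i (v T) = dg T i *: v T + off T i *: v (tab_swap i T).
Proof.
have [sT|nT] := boolP (standard T); first by rewrite tab_lfunE.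
rewrite v_nonstandard // linear0 scaler0 add0r.
have [sTs|nTs] := boolP (standard (tab_swap i T)); last first.
  by rewrite v_nonstandard // scaler0.
rewrite /off_coef; move: nT; rewrite -{1}(tab_swapK i T).
case: ifP => [/eqP p|np]; last first.
  by rewrite swap_standard // tab_swap_this tab_swap_next eq_sym np.
case: ifP => [_|nc]; first by rewrite scale0r.
rewrite swap_standard // tab_swap_this tab_swap_next negb_and.
by rewrite collinearC nc orbT.
Qed.

Lemma opG_diff_pos i T :
    node_pos (T (ord_this i)) <> node_pos (T (ord_next i)) ->
  opG i (v T) = v (tab_swap i T).
Proof.
move/eqP/negPf=> np; rewrite opGE /diag_coef /off_coef np.
by rewrite scale0r add0r scale1r.
Qed.

(** The unmodified coefficient may be used on a standard tableau: where it
    differs from the modified one, the exchanged tableau is nonstandard. *)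
Lemma opG_same_pos i T : standard T ->
    node_pos (T (ord_this i)) = node_pos (T (ord_next i)) ->
  let a := q ^ (2 * node_diag (T (ord_this i))) in
  let b := q ^ (2 * node_diag (T (ord_next i))) in
  opG i (v T) = hecke_diag q a b *: v T + hecke_off q a b *: v (tab_swap i T).
Proof.
move=> sT p; rewrite opGE /diag_coef /off_coef p eqxx; case: ifP => // col.
by rewrite (v_nonstandard (swap_collinear sT p col)) !scaler0.
Qed.

Lemma standard_separated T (a b : 'I_n) : standard T -> (a < b <= a.+2)%N ->
  separated (T a) (T b).
Proof.
move=> sT ab pab dab; have := standard_diag_gap sT pab dab; lia.
Qed.

Lemma standard_adjacent_if_collinear T i : standard T ->
  adjacent_if_collinear (T (ord_this i)) (T (ord_next i)).
Proof. by move=> sT; apply: standard_collinear_diag. Qed.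

Lemma opT_comm j k : (opT j \o opT k)%VF = (opT k \o opT j)%VF.
Proof.
apply: lfun_tabP => T _; rewrite !comp_lfunE !opTE !linearZ /= !opTE.
by rewrite !scalerA mulrC.
Qed.

Lemma opT_opG j i : (opT j \o opG i)%VF = (opG i \o opT (simple_refl i j))%VF.
Proof.
apply: lfun_tabP => T _; rewrite !comp_lfunE opTE linearZ /= !opGE.
rewrite linearD !linearZ /= !opTE scalerDr !scalerA ![zeta _ * _]mulrC.
rewrite /tab_pos tab_swapE.
congr (_ + _); congr (_ *: _).
rewrite /diag_coef; case: ifP => [/eqP p|_]; last by rewrite !mul0r.
by congr (_ * zeta _); rewrite /simple_refl; case: tpermP => [->|->|].
Qed.

Lemma opG_comm (i j : 'I_n.-1) : (i.+1 < j)%N || (j.+1 < i)%N ->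
  (opG i \o opG j)%VF = (opG j \o opG i)%VF.
Proof.
move=> far; have far' : (j.+1 < i)%N || (i.+1 < j)%N by rewrite orbC.
apply: lfun_tabP => T _.
rewrite !comp_lfunE !opGE !linearD !linearZ /= !opGE.
rewrite !tab_swapE !simple_refl_far // (tab_swapC T far).
by rewrite !scalerDr !scalerA addrACA; congr (_ + _ + (_ + _)); rewrite mulrC.
Qed.

(** Expanding both sides on v_T gives combinations of the six v_(T^w), w in the
    group generated by the two transpositions. The coefficients of the three
    w of length at least 2 agree term by term; those of the identity and of the
    two transpositions are [diag_coef_braid], [diag_coef_yb] and
    [diag_coef_yb_rev]. *)
Lemma opG_braid (i j : 'I_n.-1) : j = i.+1 :> nat ->
  (opG i \o opG j \o opG i)%VF = (opG j \o opG i \o opG j)%VF.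
Proof.
move=> ji; have ni : ord_next i = ord_this j by apply: val_inj.
have ne (a b : 'I_n) : a != b :> nat -> a != b by rewrite (inj_eq val_inj).
have si_j : simple_refl i (ord_next j) = ord_next j.
  by rewrite /simple_refl tpermD //; apply: ne => /=; lia.
have sj_i : simple_refl j (ord_this i) = ord_this i.
  by rewrite /simple_refl tpermD //; apply: ne => /=; lia.
have si1 : simple_refl i (ord_this i) = ord_this j by rewrite /simple_refl tpermL.
have si2 : simple_refl i (ord_this j) = ord_this i.
  by rewrite /simple_refl -ni tpermR.
have sj1 : simple_refl j (ord_this j) = ord_next j by rewrite /simple_refl tpermL.
have sj2 : simple_refl j (ord_next j) = ord_this j by rewrite /simple_refl tpermR.
apply: lfun_tabP => T sT; rewrite !comp_lfunE.
have GD k x y : opG k (x + y) = opG k x + opG k y by exact: linearD.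
have GZ k c x : opG k (c *: x) = c *: opG k x by exact: linearZ.
rewrite !(opGE, GD, GZ).
rewrite !tab_swapK (tab_swap_braid T ji) !tab_swapE ni.
rewrite ?(si_j, sj_i, si1, si2, sj1, sj2).
have sAB : separated (T (ord_this i)) (T (ord_this j)).
  by apply: standard_separated => //=; lia.
have sBD : separated (T (ord_this j)) (T (ord_next j)).
  by apply: standard_separated => //=; lia.
have sAD : separated (T (ord_this i)) (T (ord_next j)).
  by apply: standard_separated => //=; lia.
have cAB : adjacent_if_collinear (T (ord_this i)) (T (ord_this j)).
  by rewrite -ni; apply: standard_adjacent_if_collinear.
have cBD : adjacent_if_collinear (T (ord_this j)) (T (ord_next j)).
  exact: standard_adjacent_if_collinear.
move: (T (ord_this i)) (T (ord_this j)) (T (ord_next j)) sAB sBD sAD cAB cBD.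
move=> A B D sAB sBD sAD cAB cBD.
move: (v T) (v (tab_swap i T)) (v (tab_swap j T)) (v (tab_swap i (tab_swap j T)))
  (v (tab_swap j (tab_swap i T))) (v (tab_swap j (tab_swap i (tab_swap j T)))).
move=> x x1 x2 x12 x21 x212.
have yb := diag_coef_yb q0 q_exp_inj sAB sBD sAD.
have yb' := diag_coef_yb_rev q0 q_exp_inj sAB sBD sAD.
have br := diag_coef_braid q0 q_exp_inj sAB sBD sAD cAB cBD.
(* Only the three identities above relate the coefficients from here on. *)
move: (diag_coef q A B) (diag_coef q B A) (diag_coef q B D) (diag_coef q D B)
  (diag_coef q A D) (off_coef q A B) (off_coef q B A) (off_coef q B D)
  (off_coef q D B) (off_coef q A D) yb yb' br
  => a a' b b' e f f' h h' g yb yb' br.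
apply: vect_scalarP => phi.
have phiD z w : phi (z + w) = phi z + phi w by exact: linearD.
have phiZ c z : phi (c *: z) = c * phi z by exact: linearZ.
rewrite !(phiD, phiZ).
(* Subscripts spell the word in i (1) and j (2) applied to T. *)
move: (phi x) (phi x1) (phi x2) (phi x12) (phi x21) (phi x212).
move=> y y1 y2 y12 y21 y212.
apply/eqP; rewrite -subr_eq0; apply/eqP.
transitivity ((a ^+ 2 * b + f * f' * e - (b ^+ 2 * a + h * h' * e)) * y
  + f * (a * b + e * a' - b * e) * y1 - h * (a * b + e * b' - a * e) * y2).
  by ring.
by rewrite yb yb' br !subrr !(mulr0, mul0r, addr0, subr0).
Qed.

(** The action of the idempotent e_i, given by its effect instead of as an
    average of powers of the T_j. *)
Definition opE i : 'End(V) :=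
  tab_lfun (fun T => if tab_pos T (ord_this i) == tab_pos T (ord_next i)
                     then v T else 0).

Lemma opEE i T : opE i (v T) =
  if tab_pos T (ord_this i) == tab_pos T (ord_next i) then v T else 0.
Proof.
have [sT|nT] := boolP (standard T); first by rewrite tab_lfunE.
by rewrite v_nonstandard // linear0 if_same.
Qed.

Lemma opG_quadratic i :
  (opG i \o opG i)%VF = \1%VF + (q - q^-1) *: (opE i \o opG i)%VF.
Proof.
apply: lfun_tabP => T sT.
rewrite add_lfunE scale_lfunE id_lfunE !comp_lfunE !opGE.
rewrite !linearD !linearZ /= !opGE !opEE.
rewrite tab_swapK /tab_pos tab_swap_this tab_swap_next.
have sAB : separated (T (ord_this i)) (T (ord_next i)).
  by apply: standard_separated => //=; lia.
have cAB : adjacent_if_collinear (T (ord_this i)) (T (ord_next i)).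
  exact: standard_adjacent_if_collinear.
have quad := coef_quadratic q0 q_exp_inj sAB cAB.
have := diag_coefC q0 q_exp_inj sAB; move: quad.
rewrite [node_pos (T (ord_next i)) == _]eq_sym.
move: (v T) (v (tab_swap i T)) => x y.
move: (off_coef q _ _) (off_coef q _ _) (diag_coef q (T (ord_next i)) _)
  (diag_coef q _ _) => f' f b a quad sum.
apply: vect_scalarP => phi.
have phiD z w : phi (z + w) = phi z + phi w by exact: linearD.
have phiZ c z : phi (c *: z) = c * phi z by exact: linearZ.
(* The eigenvalue of (q - q^-1) e_i, common to T and the exchanged tableau. *)
pose s := if node_pos (T (ord_this i)) == node_pos (T (ord_next i))
          then q - q^-1 else 0.
transitivity (phi x + s * (a * phi x + f * phi y)); last first.
  by rewrite /s; case: ifP => _; rewrite !(phiD, phiZ) ?linear0; ring.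
have {}quad : a ^+ 2 + f * f' = 1 + s * a.
  by rewrite quad /s; case: ifP; rewrite ?mul0r.
have {}sum : a + b = s by [].
rewrite !(phiD, phiZ); move: (phi x) (phi y) => x' y'.
apply/eqP; rewrite -subr_eq0; apply/eqP.
transitivity ((a ^+ 2 + f * f' - (1 + s * a)) * x' + f * (a + b - s) * y').
  by ring.
by rewrite quad sum !subrr mulr0 !mul0r addr0.
Qed.
End Seminormal.

(** * The field of rational functions *)

Section GenericParameter.
Variable C : fieldType.

(** The indeterminate is not a root of unity, so distinct diagonals have
    distinct contents. *)
Lemma ratfunX_exp_inj : injective (fun m : int => @ratfunX C ^ m).
Proof.
have X1 (k : nat) : @ratfunX C ^+ k = 1 -> k = 0%N.
  rewrite /ratfunX -tofracXn -tofrac1 => /eqP; rewrite tofrac_eq => /eqP.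
  move/(congr1 (fun p : {poly C} => size p)).
  by rewrite size_polyXn size_poly1 => -[].
have Xz (z : int) : @ratfunX C ^ z = 1 -> z = 0.
  case: z => k; first by move/X1->.
  by move/(congr1 GRing.inv); rewrite invrK invr1 => /X1.
move: (@ratfunX C) (ratfunX_neq0 C) Xz => q q0 Xz a b /= Eab.
apply/eqP; rewrite -subr_eq0; apply/eqP/Xz.
by rewrite expfzDr // Eab -expfzDr // subrr.
Qed.

Lemma ratfunC_inj : injective (@ratfunC C).
Proof. by move=> a b /eqP; rewrite tofrac_eq => /eqP/polyC_inj. Qed.
End GenericParameter.

(** * The representation *)

Section EigenIdempotent.
Variables (K : fieldType) (d : nat).

(** For z different from w, multiplying by w - z telescopes the sum into
    w^d - z^d = 0, up to the factor w. *)
Lemma sum_root_powers (z w : K) : (0 < d)%N -> z ^+ d = 1 -> w ^+ d = 1 ->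
  \sum_(s < d) z ^+ s * w ^+ (d - s) = if z == w then d%:R else 0.
Proof.
move=> d0 zd wd; case: eqVneq => [<-|zw].
  rewrite (eq_bigr (fun=> 1)) ?sumr_const ?card_ord // => s _.
  by rewrite -exprD subnKC // ltnW.
have -> : \sum_(s < d) z ^+ s * w ^+ (d - s)
    = w * \sum_(s < d) w ^+ (d.-1 - s) * z ^+ s.
  rewrite mulr_sumr; apply: eq_bigr => s _.
  by rewrite mulrA -exprS mulrC; congr (_ ^+ _ * _); have := ltn_ord s; lia.
have := subrXX w z d; rewrite zd wd subrr => /esym/eqP.
by rewrite mulf_eq0 subr_eq0 eq_sym (negPf zw) /= => /eqP->; rewrite mulr0.
Qed.
End EigenIdempotent.

Section EndomorphismRing.
Variables (K : fieldType) (V : vectType K).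
Hypothesis V_proper : (0 < dim V)%N.

(** The product is composition, so the representation is on the left. *)
Definition end_ring : nzRingType := lfun_comp_nzRingType V_proper.

Definition scalar_end (c : K) : end_ring := c *: (\1%VF : 'End(V)).

Lemma scalar_end_zmod : zmod_morphism scalar_end.
Proof. by move=> a b; apply: scalerBl. Qed.
HB.instance Definition _ :=
  GRing.isZmodMorphism.Build K end_ring scalar_end scalar_end_zmod.

Lemma scalar_end_monoid : monoid_morphism scalar_end.
Proof.
split=> [|a b]; first exact: scale1r.
rewrite /scalar_end.
change (a * b *: \1%VF = ((a *: \1) \o (b *: \1))%VF :> 'End(V)).
by rewrite -comp_lfunZl -comp_lfunZr comp_lfun1l scalerA.
Qed.
HB.instance Definition _ :=
  GRing.isMonoidMorphism.Build K end_ring scalar_end scalar_end_monoid.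

Lemma scalar_endE c (s : end_ring) : scalar_end c * s = c *: (s : 'End(V)).
Proof.
change (((c *: \1) \o s)%VF = c *: s :> 'End(V)).
by rewrite -comp_lfunZl comp_lfun1l.
Qed.

Lemma scalar_end_central c (s : end_ring) : scalar_end c * s = s * scalar_end c.
Proof.
rewrite scalar_endE; change (c *: s = (s \o (c *: \1))%VF :> 'End(V)).
by rewrite -comp_lfunZr comp_lfun1r.
Qed.

Lemma end_ringM (a b : end_ring) x :
  (a * b : 'End(V)) x = (a : 'End(V)) ((b : 'End(V)) x).
Proof. exact: comp_lfunE. Qed.

Lemma end_eigenX (a : end_ring) z x m : (a : 'End(V)) x = z *: x ->
  ((a ^+ m : end_ring) : 'End(V)) x = z ^+ m *: x.
Proof.
move=> ax; elim: m => [|m IH]; first by rewrite scale1r; apply: id_lfunE.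
by rewrite exprSr end_ringM ax linearZ /= IH scalerA exprS.
Qed.
End EndomorphismRing.

Section YokonumaHeckeRepresentation.
Variables (C : fieldType) (d n : nat) (d0 : (0 < d)%N).
Hypothesis d_char : (d%:R : C) != 0.
Variable xi : 'I_d -> C.
Hypotheses (xi_inj : injective xi) (xi_root : forall k, xi k ^+ d = 1).
Variable la : dpartition d n.
Local Notation K := (ratfun C).
Local Notation q := (@ratfunX C).
Local Notation incl := (val : {rmorphism laurent C -> K}).
Variables (V : vectType K) (v : dtableau la -> V).
Hypothesis v_basis : basis_of {:V} [seq v T | T in standard].
Hypothesis v_nonstandard : forall T : dtableau la, ~~ standard T -> v T = 0.
Hypothesis V_proper : (0 < dim V)%N.

Definition gen_end (x : YH_index n) : end_ring V_proper :=
  match x with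
  | inl i => opG q v i
  | inr j => opT v (fun k => ratfunC (xi k)) j
  end.
Local Notation zeta k := (ratfunC (xi k)).
Local Notation f := (@scalar_end K V V_proper \o incl).
Local Notation ev := (free_eval f gen_end).

Lemma zeta_root k : zeta k ^+ d = 1.
Proof. by rewrite /ratfunC -tofracXn -polyC_exp xi_root -tofrac1. Qed.

Lemma ev_e i : ev (YH_e C d i) = opE v i.
Proof.
have fc c s : f c * s = s * f c by exact: scalar_end_central.
have [ev1 evM] := free_eval_multiplicative gen_end fc.
have evX x m : ev (x ^+ m) = ev x ^+ m.
  by elim: m => [|m IH]; [rewrite !expr0|rewrite !exprS evM IH].
apply: (lfun_tabP v_basis) => T sT.
rewrite /YH_e free_evalZ (raddf_sum ev) /=.
rewrite (opEE v_basis) // scalar_endE scale_lfunE sum_lfunE.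
rewrite (eq_bigr (fun s : 'I_d => (zeta (tab_pos T (ord_this i)) ^+ s
    * zeta (tab_pos T (ord_next i)) ^+ (d - s)) *: v T)); last first.
  move=> s _; rewrite evM !evX !free_eval_gen end_ringM.
  have tE m j : ((gen_end (inr j) ^+ m : end_ring V_proper) : 'End(V)) (v T)
      = zeta (tab_pos T j) ^+ m *: v T.
    exact/end_eigenX/opTE.
  by rewrite tE linearZ /= tE scalerA mulrC.
rewrite -scaler_suml sum_root_powers ?zeta_root //.
rewrite (inj_eq (@ratfunC_inj C)) (inj_eq xi_inj); case: ifP => _.
  have dK : d%:R = ratfunC (d%:R : C).
    by rewrite /ratfunC polyC_natr; apply/esym/rmorph_nat.
  by rewrite scalerA dK -tofracM -polyCM mulVf // tofrac1 scale1r.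
by rewrite scale0r scaler0.
Qed.

Lemma YH_rel_end l r : YH_rel (C := C) d (n := n) l r -> ev l = ev r.
Proof.
have fc c s : f c * s = s * f c by exact: scalar_end_central.
have [ev1 evM] := free_eval_multiplicative gen_end fc.
have evX x m : ev (x ^+ m) = ev x ^+ m.
  by elim: m => [|m IH]; [rewrite !expr0|rewrite !exprS evM IH].
have ev2 x y : ev (fgen _ x * fgen _ y) = gen_end x * gen_end y.
  by rewrite evM !free_eval_gen.
have ev3 x y : ev (fgen _ x * fgen _ y * fgen _ x)
    = gen_end x * gen_end y * gen_end x.
  by rewrite evM ev2 free_eval_gen.
have q0 := ratfunX_neq0 C; have qi := @ratfunX_exp_inj C.
case=> [i j far|i j ji|i j|j i|j|i].
- apply: etrans (ev2 _ _) (etrans _ (esym (ev2 _ _))).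
  exact: (opG_comm q v_basis v_nonstandard far).
- apply: etrans (ev3 _ _) (etrans _ (esym (ev3 _ _))).
  exact: (opG_braid q0 qi v_basis v_nonstandard ji).
- apply: etrans (ev2 _ _) (etrans _ (esym (ev2 _ _))).
  exact: (opT_comm v_basis v_nonstandard).
- apply: etrans (ev2 _ _) (etrans _ (esym (ev2 _ _))).
  exact: (opT_opG q v_basis v_nonstandard).
- rewrite evX ev1 free_eval_gen; apply: (lfun_tabP v_basis) => T _.
  rewrite (end_eigenX d (opTE v_basis v_nonstandard _ _ _)) zeta_root.
  by rewrite scale1r; apply/esym/id_lfunE.
- rewrite evX free_eval_gen (raddfD ev) /= ev1 free_evalZ evM ev_e free_eval_gen.
  rewrite scalar_endE expr2 /=.
  exact: (opG_quadratic q0 qi v_basis v_nonstandard).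
Qed.
End YokonumaHeckeRepresentation.

Theorem proposition5 (R : realType) (d n : nat) (hd : (0 < d)%N) (hn : (0 < n)%N)
    (xi : 'I_d -> R[i])
    (xi_inj : injective xi)
    (xi_roots : forall z : R[i], z ^+ d = 1 <-> exists k, z = xi k)
    (la : dpartition d n)
    (V : vectType (ratfun R[i])) (v : dtableau la -> V)
    (v_basis : basis_of {:V} [seq v T | T in standard])
    (v_nonstandard : forall T : dtableau la, ~~ standard T -> v T = 0) :
  exists rho : ratYokonumaHecke R[i] d n -> 'End(V),
    is_representation rho /\
    forall T : dtableau la, standard T ->
      let q : ratfun R[i] := ratfunX in
      let p := tab_pos T in
      let c := tab_content R[i] T in
      (forall j : 'I_n,
          rho (YH_t R[i] d j) (v T) = ratfunC (xi (p j)) *: v T) /\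
      (forall i : 'I_n.-1,
          let i0 := ord_this i in
          let i1 := ord_next i in
          let Ts := dtableau_perm (simple_refl i) T in
          (p i0 <> p i1 -> rho (YH_g R[i] d i) (v T) = v Ts) /\
          (p i0 = p i1 ->
            rho (YH_g R[i] d i) (v T) =
              (c i1 * (q - q^-1) / (c i1 - c i0)) *: v T
              + ((q * c i1 - q^-1 * c i0) / (c i1 - c i0)) *: v Ts)).
Proof.
(* The endomorphisms form a nontrivial ring only if V is nonzero; on the zero
   space every equation holds. *)
have [V_proper|V_trivial] := ltnP 0 (dim V); last first.
  have V1 (x y : V) : x = y.
    apply: VectorInternalTheory.v2r_inj; apply/rowP => -[k ltk].
    by have := leq_trans ltk V_trivial.
  exists (fun=> 0); split; last first.
    by move=> T _; split=> [j|i]; [|split=> _]; apply: V1.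
  by split=> [a x y||x y]; apply/lfunP => w; apply: V1.
have d_char : (d%:R : R[i]) != 0 by rewrite Num.Theory.pnatr_eq0 -lt0n.
have xi_root k : xi k ^+ d = 1 by apply/xi_roots; exists k.
have [rho [rhoD [rho1 rhoM] rhoZ rhoE]] :=
  ext_scalars_lift (@scalar_end_central _ _ V_proper)
    (@YH_rel_end _ _ _ hd d_char _ xi_inj xi_root _ _ _ v_basis v_nonstandard
       V_proper).
exists rho; split.
  split; [move=> a x y|exact: rho1|exact: rhoM].
  by rewrite rhoD rhoZ scalar_endE.
move=> T sT q p c; split=> [j|i i0 i1 Ts].
  by rewrite /YH_t rhoE; apply: (opTE v_basis v_nonstandard).
rewrite /YH_g rhoE; split=> pp.
  exact: (opG_diff_pos _ v_basis v_nonstandard pp).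
have /= := opG_same_pos (@ratfunX R[i]) v_basis v_nonstandard sT pp.
rewrite /hecke_diag /hecke_off /c /q /tab_content /node_diag -/i0 -/i1.
by apply.
Qed.
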